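(* Let $r\geq 1$ and $\ell_1,\ell_2,\dots,\ell_r\geq 1$ be integers. Let $Q$ be the star-shaped quiver with vertices $c$ and $v_{i,j}$ ($1\leq i\leq r$, $1\leq j\leq\ell_i$), with a unique source $c$ and $r$ rays $$c\to v_{i,1}\to v_{i,2}\to\cdots\to v_{i,\ell_i}\qquad(1\leq i\leq r),$$ these being all the arrows of $Q$. Let $X$ be an indecomposable representation of $Q$ with values in the category of pointed sets. Then the poset $(\mathcal{P}_X,\leq)$ is Sperner.
   Context: A pointed set $(A,0_A)$ is a set $A$ with a distinguished element $0_A\in A$. A pointed subset of $(A,0_A)$ is a subset containing $0_A$, with basepoint $0_A$. A morphism $f\colon(A,0_A)\to(B,0_B)$ is a map with $f(0_A)=0_B$ whose restriction to $A\setminus f^{-1}(0_B)$ is injective; isomorphisms are the invertible morphisms. The direct sum $(A,0_A)\oplus(B,0_B)$ is $(A\setminus\{0_A\})\sqcup(B\setminus\{0_B\})\sqcup\{0\}$ with basepoint $0$. The dimension of $(A,0_A)$ is $\dim(A,0_A)=|A|-1$, the number of non-basepoint elements; the pointed set of dimension $0$ is denoted $0$. A representation $X$ of a quiver $Q=(Q_0,Q_1)$ with values in pointed sets assigns a pointed set $(X_i,0_{X_i})$ to each vertex $i\in Q_0$ and a morphism of pointed sets $X_\alpha\colon X_i\to X_j$ to each arrow $\alpha\colon i\to j$. A morphism $\phi\colon X\to Y$ is a family of morphisms of pointed sets $\phi_i\colon X_i\to Y_i$ with $Y_\alpha\circ\phi_i=\phi_j\circ X_\alpha$ for every arrow $\alpha\colon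 i\to j$; it is an isomorphism if every $\phi_i$ is an isomorphism. The direct sum $X\oplus Y$ has $(X\oplus Y)_i=X_i\oplus Y_i$ and $(X\oplus Y)_\alpha$ acting as $X_\alpha$ on the elements of $X_i\setminus\{0_{X_i}\}$ and as $Y_\alpha$ on the elements of $Y_i\setminus\{0_{Y_i}\}$ (basepoints being identified). The zero representation has $X_i=0$ for all $i$. A representation is decomposable if it is isomorphic to a direct sum of two nonzero representations, and indecomposable otherwise. A subrepresentation $U$ of $X$ is given by pointed subsets $U_i\subseteq X_i$ with $X_\alpha(U_i)\subseteq U_j$ for every arrow $\alpha\colon i\to j$, with the restricted maps. $\mathcal{P}_X$ is the set of all subrepresentations of $X$, ordered by $U\leq U'$ if and only if $U$ is a subrepresentation of $U'$. It is graded by the degree map $U\mapsto\dim(U)=\sum_{i\in Q_0}\dim(U_i,0_{U_i})$. A poset $P$ is graded by $\deg\colon P\to\mathbb{N}$ if $\deg(x)=0$ for all minimal elements $x$ and $\deg(x)=\deg(y)+1$ whenever $x$ covers $y$. For a finite, bounded, graded poset $P$, let $P_i$ denote the set of elements of degree $i$; $P$ is called Sperner if there exists a natural number $i$ such that $|\mathcal{F}|\leq|P_i|$ for every antichain $\mathcal{F}\subseteq P$ (an antichain being a subset of pairwise incomparable elements). *)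

(* Defs.v *)
From HB Require Import structures.
From mathcomp Require Import all_boot all_order finmap.
From mathcomp Require Import boolp classical_sets functions cardinality.

Set Implicit Arguments.
Unset Strict Implicit.
Unset Printing Implicit Defensive.

Import Order.TTheory.

Local Open Scope classical_set_scope.

(* A pointed set is a [pointedType] [A], with basepoint [point : A]; no
   finiteness is assumed. *)

Definition pointed_mor (A B : pointedType) (f : A -> B) : Prop :=
  f point = point /\ set_inj (~` (f @^-1` [set point])) f.

Definition pointed_iso (A B : pointedType) (f : A -> B) : Prop :=
  pointed_mor f /\
  exists g : B -> A, [/\ pointed_mor g, cancel f g & cancel g f].

(* The basepoint of the direct sum is [None]. *)
Definition psum (A B : pointedType) : pointedType :=
  option ({x : A | x != point} + {y : B | y != point}).

(* [insub y] is [None] exactly when [y = point], so an element that [f] or [g]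
   sends to the basepoint is sent to the basepoint of the sum. *)
Definition psum_map (A B A' B' : pointedType) (f : A -> A') (g : B -> B')
    (z : psum A B) : psum A' B' :=
  match z with
  | None => None
  | Some (inl x) => omap inl (insub (f (val x)))
  | Some (inr y) => omap inr (insub (g (val y)))
  end.

Lemma psum_map_mor (A B A' B' : pointedType) (f : A -> A') (g : B -> B') :
  pointed_mor f -> pointed_mor g -> pointed_mor (psum_map f g).
Proof.
move=> [_ injf] [_ injg]; split=> // z1 z2.
rewrite !inE /psum_map => h1 h2.
case: z1 h1 => [[x1|y1]|] h1 //; last by case: h1.
all: case: z2 h2 => [[x2|y2]|] // h2.
- move: h1 h2; rewrite /=.
  case: (insubP {x : A' | x != point} (f (val x1))) => // u1 n1 e1 _.
  case: (insubP {x : A' | x != point} (f (val x2))) => // u2 n2 e2 _ [e12].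
  congr (Some (inl _)); apply: val_inj; apply: injf.
  by rewrite inE /=; apply/eqP.
  by rewrite inE /=; apply/eqP.
  by rewrite -e1 -e2 e12.
- by move: h1 h2 => /=; do 2 case: insub.
- by move: h1 h2 => /=; do 2 case: insub.
- move: h1 h2; rewrite /=.
  case: (insubP {y : B' | y != point} (g (val y1))) => // u1 n1 e1 _.
  case: (insubP {y : B' | y != point} (g (val y2))) => // u2 n2 e2 _ [e12].
  congr (Some (inr _)); apply: val_inj; apply: injg.
  by rewrite inE /=; apply/eqP.
  by rewrite inE /=; apply/eqP.
  by rewrite -e1 -e2 e12.
Qed.

Record quiver := Quiver {
  vertex : finType;
  arrow : finType;
  source : arrow -> vertex;
  target : arrow -> vertex }.

Record representation (Q : quiver) := Representation {
  space :> vertex Q -> pointedType;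
  rmap : forall a : arrow Q, space (source a) -> space (target a);
  rmap_mor : forall a : arrow Q, pointed_mor (rmap (a := a)) }.

Definition rep_mor (Q : quiver) (X Y : representation Q)
    (phi : forall i : vertex Q, X i -> Y i) : Prop :=
  (forall i, pointed_mor (phi i)) /\
  (forall (a : arrow Q) (x : X (source a)),
      rmap (phi (source a) x) = phi (target a) (rmap x)).

Definition rep_isomorphic (Q : quiver) (X Y : representation Q) : Prop :=
  exists2 phi : forall i : vertex Q, X i -> Y i,
    rep_mor phi & forall i, pointed_iso (phi i).

Definition rep_sum (Q : quiver) (X Y : representation Q) : representation Q :=
  @Representation Q (fun i => psum (X i) (Y i))
    (fun a => psum_map (@rmap Q X a) (@rmap Q Y a))
    (fun a => psum_map_mor (rmap_mor X a) (rmap_mor Y a)).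

Definition rep_zero (Q : quiver) (X : representation Q) : Prop :=
  forall (i : vertex Q) (x : X i), x = point.

Definition decomposable (Q : quiver) (X : representation Q) : Prop :=
  exists Y Z : representation Q,
    [/\ ~ rep_zero Y, ~ rep_zero Z & rep_isomorphic X (rep_sum Y Z)].

Definition indecomposable (Q : quiver) (X : representation Q) : Prop :=
  ~ decomposable X.

Record subrep (Q : quiver) (X : representation Q) := Subrep {
  subspace :> forall i : vertex Q, set (X i);
  subrep_point : forall i, @subspace i point;
  subrep_rmap : forall a : arrow Q,
    [set rmap x | x in @subspace (source a)] `<=` @subspace (target a) }.

Arguments subspace {Q X} _ _ _.

Section SubrepOrder.
Variables (Q : quiver) (X : representation Q).

HB.instance Definition _ := gen_eqMixin (subrep X).
HB.instance Definition _ := gen_choiceMixin (subrep X).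

Definition subrep_le (U V : subrep X) : bool :=
  `[< forall i, U i `<=` V i >].

Fact subrep_le_refl : reflexive subrep_le.
Proof. by move=> U; apply/asboolP => i. Qed.

Fact subrep_le_anti : antisymmetric subrep_le.
Proof.
move=> [U pU rU] [V pV rV] /andP[/asboolP /= UV /asboolP /= VU].
have eUV : U = V by apply: functional_extensionality_dep => i; apply/seteqP.
subst V; congr Subrep; exact: Prop_irrelevance.
Qed.

Fact subrep_le_trans : transitive subrep_le.
Proof.
move=> V U W /asboolP UV /asboolP VW; apply/asboolP => i.
exact: subset_trans (UV i) (VW i).
Qed.

Fact subrep_display : Order.disp_t. Proof. exact: Order.Disp tt tt. Qed.

HB.instance Definition _ := Order.Le_isPOrder.Build subrep_display (subrep X)
  subrep_le_refl subrep_le_anti subrep_le_trans.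

End SubrepOrder.

(* Meaningful for finite [A] only: [fset_set A] is empty when [A] is infinite. *)
Definition pdim (T : pointedType) (A : set T) : nat := #|` fset_set A|.-1.

Definition subrep_dim (Q : quiver) (X : representation Q) (U : subrep X) : nat :=
  \sum_(i : vertex Q) pdim (U i).

Section Sperner.
Variables (d : Order.disp_t) (P : porderType d).
Local Open Scope order_scope.

Definition minimal (x : P) : Prop := forall y, ~~ (y < x).

Definition covers (x y : P) : Prop := y < x /\ forall z, ~~ (y < z < x).

Definition graded (deg : P -> nat) : Prop :=
  (forall x, minimal x -> deg x = 0%N) /\
  (forall x y, covers x y -> deg x = (deg y).+1).

Definition bounded : Prop :=
  (exists b : P, forall x, b <= x) /\ (exists t : P, forall x, x <= t).

Definition antichain (F : set P) : Prop :=
  forall x y, F x -> F y -> x <> y -> x >< y.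

Definition sperner (deg : P -> nat) : Prop :=
  [/\ finite_set [set: P], bounded, graded deg &
      exists i : nat, forall F : set P,
        antichain F -> (F #<= [set x | deg x = i])%card].

End Sperner.

Section Star.
Variables (r : nat) (ell : 'I_r -> nat).

(* The center c is [None]; since rays and positions are numbered from 0, the
   vertex v_{i,j} is [Some (Tagged _ k)] with [tag = i - 1] and [k = j - 1]. *)
Definition star_vertex : finType := option {i : 'I_r & 'I_(ell i)}.

(* Every vertex v_{i,j} receives exactly one arrow, by which that arrow is
   indexed; it starts at c if j = 1, and at v_{i,j-1} otherwise. *)
Definition star_arrow : finType := {i : 'I_r & 'I_(ell i)}.

Definition star_source (a : star_arrow) : star_vertex :=
  let: existT i (Ordinal k lt_k) := a in
  match k return (k < ell i)%N -> star_vertex with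
  | 0 => fun=> None
  | k'.+1 => fun lt_k =>
      Some (existT (fun i => 'I_(ell i)) i (Ordinal (ltnW lt_k)))
  end lt_k.

Definition star_target (a : star_arrow) : star_vertex := Some a.

Definition star_quiver : quiver := Quiver star_source star_target.

End Star.

(* Main.v *)
Require Import Defs.
From HB Require Import structures.
From mathcomp Require Import all_boot all_order finmap zify.
From mathcomp Require Import boolp classical_sets functions cardinality.

(** Every vertex of the star receives at most one arrow and the maps of a
    representation are injective away from their kernels, so a nonzero element
    of [X] comes from at most one nonzero element. Hence the elements of [X]
    form a forest. Splitting off the descendants of an element [x0] of minimal
    depth exhibits [X] as a direct sum; if [X] is indecomposable, every nonzero
    element descends from [x0]. A descendant of [x0] is determined by its vertex,
    so [X] has at most one nonzero element per vertex (it is [thin]) and its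
    support [Z] is a connected part of the star ([indecomposable_thin_rooted]).

    A subrepresentation is then a subset of [Z] closed under the arrows inside
    [Z] ([subrep_support_le], [subrep_support_onto]), with its cardinality as
    degree. On each ray such a subset is an upper segment of the part of [Z] on
    that ray, determined by its length; and if it contains the center, it is all
    of [Z]. So the poset of subrepresentations is a product of chains, with one
    more element on top if the center belongs to [Z].

    A product of chains has a symmetric chain decomposition. It is encoded by a
    label, [chain_label], such that elements with the same label are comparable
    ([chain_label_comparable]) and every label that occurs is taken by an element
    of middle rank ([chain_label_onto]). Sending each subrepresentation to one of
    middle rank with the same label is injective on antichains, so the middle
    rank of the product of chains is as large as any antichain. The possible
    extra top element is comparable to everything, so it can be given the label of
    the greatest element of the product. *)

Set Implicit Arguments.
Unset Strict Implicit.
Unset Printing Implicit Defensive.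

(** * A symmetric chain decomposition of a product of chains *)

(** The product of the chains [0, mi] is decomposed one factor at a time. In the
    product of the factors of [m'], the symmetric chain of [x'] starts at some
    rank [a] and ends at rank [sumn m' - a]. Its product with the chain [0, mi]
    is a rectangle, which is cut into the hooks
    [(0, h) .. (L - h, h) .. (L - h, mi)] where [L = sumn m' - 2 * a]: the point
    at position [t] on the first side and [xi] on the second lies on the hook
    [h = minn xi (L - t)]. A chain is named by the sequence of its hooks, the
    sum of which is its starting rank [a]. *)
Fixpoint chain_label (m x : seq nat) : seq nat :=
  match m, x with
  | mi :: m', xi :: x' =>
      minn xi (sumn m' - sumn (chain_label m' x') - sumn x')
        :: chain_label m' x'
  | _, _ => [::]
  end.

(** The chain of [x] runs from rank [sumn (chain_label m x)] up to the
    complementary rank, and [x] is on it. *)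
Lemma chain_label_bounds (m x : seq nat) : all2 leq x m ->
  sumn (chain_label m x) <= sumn x /\
  sumn (chain_label m x) + sumn x <= sumn m.
Proof.
by elim: m x => [|mi m IH] [|xi x] //= /andP[le_xi /IH[]]; lia.
Qed.

(** Along a hook both coordinates are nondecreasing functions of the rank: if one
    went up while the other went down, the minimum defining the hook would
    change. *)
Lemma chain_label_comparable (m x y : seq nat) :
  all2 leq x m -> all2 leq y m -> chain_label m x = chain_label m y ->
  sumn x <= sumn y -> all2 leq x y.
Proof.
elim: m x y => [|mi m IH] [|xi x] [|yi y] //=.
move=> /andP[le_xi xm] /andP[le_yi ym] [eq_h eq_lab] le_sum.
have [bx1 bx2] := chain_label_bounds xm.
have [by1 by2] := chain_label_bounds ym.
rewrite -eq_lab in eq_h by1 by2.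
have -> : xi <= yi by lia.
by apply: IH => //; lia.
Qed.

(** A chain of the decomposition skips no rank between its two ends; these are
    symmetric, so it meets the middle rank. *)
Lemma chain_label_onto (m x : seq nat) (p : nat) : all2 leq x m ->
  sumn (chain_label m x) <= p <= sumn m - sumn (chain_label m x) ->
  exists y : seq nat,
    [/\ all2 leq y m, chain_label m y = chain_label m x & sumn y = p].
Proof.
elim: m x p => [|mi m IH] [|xi x] //= p.
  by move=> _; rewrite leqn0 => /eqP ->; exists [::].
move=> /andP[le_xi xm]; have [b1 b2] := chain_label_bounds xm.
have := IH x _ xm; move: b1 b2.
set a := sumn (chain_label m x); set h := minn _ _ => b1 b2 {}IH le_p.
(* Rank [p] is on the first side of the hook, where the last coordinate is [h],
   or on the second side, where the rank in the other factors is fixed at the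
   largest value [sumn m - a - h] that the hook allows. *)
have [le_p'|lt_p] := leqP (p - h) (sumn m - a - h).
- have [|y [ym lab sy]] := IH (p - h); first lia.
  exists (h :: y).
  split=> /=; [by rewrite ym; lia | rewrite lab -/a | ]; try lia.
  by congr cons; lia.
- have [|y [ym lab sy]] := IH (sumn m - a - h); first lia.
  exists (p - (sumn m - a - h) :: y).
  split=> /=; [by rewrite ym; lia | rewrite lab -/a | ]; try lia.
  by congr cons; lia.
Qed.

(** * Upper segments of a subset of an interval *)

Section IntervalSubsets.
Variable l : nat.
Implicit Types A B S : {set 'I_l}.

Definition upper_in S A :=
  forall k k' : 'I_l, k \in A -> k' \in S -> k <= k' -> k' \in A.

Lemma upper_in_subset S A B : A \subset S -> B \subset S ->
  upper_in S A -> upper_in S B -> #|A| <= #|B| -> A \subset B.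
Proof.
move=> AS BS upA upB leAB; apply/fintype.subsetP => a aA; apply: contraT => aB.
have BA : B \subset A :\ a.
  apply/fintype.subsetP => b bB; rewrite !finset.inE; apply/andP; split.
    by apply: contraNneq aB => <-.
  have [le_ab|/ltnW le_ba] := leqP a b.
    by apply: upA aA _ le_ab; apply: (fintype.subsetP BS).
  by case/negP: aB; apply: upB bB _ le_ba; apply: (fintype.subsetP AS).
have := subset_leq_card BA; have := cardsD1 a A; rewrite aA; lia.
Qed.

(** Raising the threshold [t] by one in [[set k in S | t <= k]] removes at most
    one element, so all cardinalities up to that of [S] occur. *)
Lemma upper_in_card S (n : nat) : n <= #|S| ->
  exists A, [/\ A \subset S, upper_in S A & #|A| = n].
Proof.
move=> len; pose T (t : nat) := [set k in S | t <= k].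
have ex : exists t, #|T t| <= n.
  exists l; rewrite (_ : T l = finset.set0) ?cards0 //.
  by apply/setP => k; rewrite !finset.inE leqNgt ltn_ord andbF.
case: (ex_minnP ex) => t le_t min_t.
exists (T t); split.
- by apply/fintype.subsetP => k; rewrite finset.inE => /andP[].
- by move=> k k'; rewrite !finset.inE => /andP[_ le_tk] -> /(leq_trans le_tk).
- apply/eqP; rewrite eqn_leq le_t /=.
  case: t le_t min_t => [|t] le_t min_t.
    apply: leq_trans len _; apply: subset_leq_card.
    by apply/fintype.subsetP => k; rewrite finset.inE andbT.
  have lt_n : n < #|T t| by rewrite ltnNge; apply/negP => /min_t; rewrite ltnn.
  have [lt_tl|le_lt] := ltnP t l; last first.
    move: lt_n; rewrite (_ : T t = finset.set0) ?cards0 //.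
    by apply/setP => k; rewrite !finset.inE leqNgt (leq_trans (ltn_ord k) le_lt) andbF.
  have TS : T t \subset Ordinal lt_tl |: T t.+1.
    apply/fintype.subsetP => k; rewrite !finset.inE => /andP[-> le_tk] /=.
    by rewrite -val_eqE /=; lia.
  have := leq_trans lt_n (subset_leq_card TS).
  by rewrite cardsU1; case: (_ \notin _); [|move/ltnW].
Qed.

End IntervalSubsets.

(** * Complementary subrepresentations *)

Local Open Scope classical_set_scope.

(** The proof [S0] occurs in the type so that the basepoint can be recovered from
    it by instance inference. *)
Definition pointed_subset (A : pointedType) (S : set A) (S0 : S point) : Type :=
  {x : A | x \in S}.

Section PointedSubset.
Variables (A : pointedType) (S : set A) (S0 : S point).
HB.instance Definition _ := SubChoice.on (pointed_subset S0).
HB.instance Definition _ :=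
  isPointed.Build (pointed_subset S0) (exist _ point (mem_set S0)).
End PointedSubset.

Section Restriction.
Variables (Q : quiver) (X : representation Q) (U : subrep X).

Lemma subrep_rmap_mem (a : arrow Q) (x : X (source a)) :
  x \in U (source a) -> rmap x \in U (target a).
Proof. by move=> /set_mem Ux; apply/mem_set/subrep_rmap; exists x. Qed.

Definition restr_map (a : arrow Q)
    (x : pointed_subset (@subrep_point Q X U (source a))) :
    pointed_subset (@subrep_point Q X U (target a)) :=
  exist _ (rmap (val x)) (subrep_rmap_mem (valP x)).

Lemma restr_map_mor (a : arrow Q) : pointed_mor (@restr_map a).
Proof.
have [f0 finj] := rmap_mor X a; split; first exact: val_inj.
move=> x y nx ny /(congr1 val) /= exy.
apply/val_inj/finj => //.
  by apply/mem_set => e; move/set_mem: nx; apply; apply: val_inj.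
by apply/mem_set => e; move/set_mem: ny; apply; apply: val_inj.
Qed.

Definition restr_rep : representation Q :=
  @Representation Q (fun i => pointed_subset (@subrep_point Q X U i))
    restr_map restr_map_mor.

End Restriction.

Lemma bijective_rep_isomorphic (Q : quiver) (X Y : representation Q)
    (psi : forall i, Y i -> X i) :
  (forall i, psi i point = point) -> (forall i, injective (psi i)) ->
  (forall i x, exists y, psi i y = x) ->
  (forall a (y : Y (source a)), rmap (psi _ y) = psi _ (rmap y)) ->
  rep_isomorphic X Y.
Proof.
move=> psi0 psi_inj psi_surj psi_rmap.
pose phi i (x : X i) : Y i := sval (cid (psi_surj i x)).
have phiK i : cancel (phi i) (psi i) by move=> x; rewrite /phi; case: cid.
have psiK i : cancel (psi i) (phi i) by move=> y; apply: psi_inj; rewrite phiK.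
have phi0 i : phi i point = point by apply: psi_inj; rewrite phiK psi0.
have phi_mor i : pointed_mor (phi i).
  by split=> // x y _ _; apply: can_inj (phiK i) _ _.
exists phi.
  split=> // a x; apply: psi_inj.
  by rewrite phiK -psi_rmap phiK.
move=> i; split=> //; exists (psi i); split=> //.
by split=> // x y _ _; apply: psi_inj.
Qed.

Lemma complement_decomposable (Q : quiver) (X : representation Q)
    (U V : subrep X) :
  (forall i x, U i x -> V i x -> x = point) -> (forall i x, U i x \/ V i x) ->
  (exists i, exists2 x, U i x & x != point) ->
  (exists i, exists2 x, V i x & x != point) -> decomposable X.
Proof.
move=> UV0 UVT [i [x Ux nx]] [j [y Vy ny]].
exists (restr_rep U), (restr_rep V); split.
- move=> /(_ i (exist _ x (mem_set Ux))) /(congr1 val) /= e.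
  by rewrite e eqxx in nx.
- move=> /(_ j (exist _ y (mem_set Vy))) /(congr1 val) /= e.
  by rewrite e eqxx in ny.
pose psi k (z : rep_sum (restr_rep U) (restr_rep V) k) : X k :=
  match z with
  | None => point
  | Some (inl u) => val (val u)
  | Some (inr v) => val (val v)
  end.
have nval (W : subrep X) k (u : {u : restr_rep W k | u != point}) :
    val (val u) <> point.
  by move=> e; move: (valP u) => /eqP; apply; apply: val_inj.
have meet0 k (p q : X k) : p \in U k -> q \in V k -> p = q -> p = point.
  by move=> /set_mem Up /set_mem Vq epq; apply: UV0 Up _; rewrite epq.
apply: (bijective_rep_isomorphic (psi := psi)) => //.
- move=> k [[u|v]|] [[u'|v']|] //=.
  + by move=> /val_inj /val_inj ->.
  + move=> e; case: (nval _ _ u).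
    exact: meet0 (valP (val u)) (valP (val v')) e.
  + by move=> /nval.
  + move=> e; case: (nval _ _ u').
    exact: meet0 (valP (val u')) (valP (val v)) (esym e).
  + by move=> /val_inj /val_inj ->.
  + by move=> /nval.
  + by move=> /esym/nval.
  + by move=> /esym/nval.
- move=> k w; have [->|nw] := eqVneq w point; first by exists None.
  have [Uw|Vw] := UVT k w.
  + pose u : restr_rep U k := exist _ w (mem_set Uw).
    have nu : u != point by apply: contraNneq nw => /(congr1 val) /= ->.
    by exists (Some (inl (exist _ u nu))).
  + pose u : restr_rep V k := exist _ w (mem_set Vw).
    have nu : u != point by apply: contraNneq nw => /(congr1 val) /= ->.
    by exists (Some (inr (exist _ u nu))).
- move=> a [[u|v]|] /=; last by case: (rmap_mor X a).
  + by case: insubP => [w _ /(congr1 val) /esym //|] /=;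
       rewrite negbK => /eqP /(congr1 val).
  + by case: insubP => [w _ /(congr1 val) /esym //|] /=;
       rewrite negbK => /eqP /(congr1 val).
Qed.

(** * Indecomposable representations of forest quivers *)

Section ForestRepresentations.
Variables (Q : quiver) (X : representation Q).

Definition thin := forall (i : vertex Q) (x y : X i),
  x != point -> y != point -> x = y.

Definition live (i : vertex Q) := exists x : X i, x != point.

(** The roots of the forest of nonzero elements all lie at the least depth where
    [X] is nonzero. *)
Definition rooted (depth : vertex Q -> nat) :=
  forall (a : arrow Q) (i : vertex Q),
  live i -> depth i < depth (target a) -> forall y : X (target a), y != point ->
  exists2 x : X (source a), x != point & y = rmap x.

End ForestRepresentations.

Section ForestQuiver.
Variables (Q : quiver) (depth : vertex Q -> nat).
Hypothesis target_inj : injective (@target Q).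
Hypothesis depth_target : forall a : arrow Q,
  depth (target a) = (depth (source a)).+1.
Variable X : representation Q.

Notation element := {i : vertex Q & X i}.
Notation Elt i x := (existT (fun k => space X k) i x).

Inductive descendant (x0 : element) : element -> Prop :=
| descendant_refl : descendant x0 x0
| descendant_rmap a (x : X (source a)) :
    descendant x0 (Elt _ x) -> descendant x0 (Elt _ (rmap x)).

Lemma descendant_depth (x0 x : element) :
  descendant x0 x -> depth (tag x0) <= depth (tag x).
Proof. by elim=> // a y _ /=; rewrite depth_target => /leqW. Qed.

Lemma descendant_target (x0 : element) (a : arrow Q) (y : X (target a)) :
  descendant x0 (Elt _ y) -> x0 = Elt _ y \/
  exists2 x : X (source a), descendant x0 (Elt _ x) & y = rmap x.
Proof.
move e: (Elt _ y) => ye dy; case: dy e => [|b x dx] e; first by left.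
right; have eab : a = b by apply: target_inj; move/(congr1 tag): e.
case: b / eab x dx e => x dx e; exists x => //.
exact: (@eq_from_Tagged (vertex Q) (fun i => space X i) _ _ _ e).
Qed.

(** Two descendants of [x0] at the same vertex come through the same arrows,
    since a vertex receives at most one arrow, and they take the same number of
    steps, by depth. *)
Lemma descendant_unique (x0 : element) (i : vertex Q) (x y : X i) :
  descendant x0 (Elt i x) -> descendant x0 (Elt i y) -> x = y.
Proof.
move e: (Elt i x) => xe dx; elim: dx i x y e => {xe} [|a x' dx' IH] i x y e dy.
  case: x0 e dy => j z [] eji; case: j / eji z => z ez.
  rewrite -(eq_from_Tagged ez).
  move e: (Elt _ y) => ye dy; case: dy e => [|b w /descendant_depth le_d] e.
    exact: (esym (eq_from_Tagged e)).
  have /= ed := congr1 (fun z => depth (tag z)) e.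
  by move: le_d; rewrite /= ed depth_target ltnn.
have /= ei := congr1 tag e; subst i.
rewrite (eq_from_Tagged e).
have [ex0|[y' dy' ->]] := descendant_target dy.
  by have := descendant_depth dx'; rewrite ex0 /= depth_target ltnn.
by rewrite (IH _ x' y').
Qed.

(** If [x0] is a nonzero element of minimal depth, no other nonzero element maps
    into its set of descendants: such an element would lie above [x0], or, by
    injectivity away from the kernel, be itself a descendant. So descendants and
    non-descendants are complementary subrepresentations, and the latter vanish
    if [X] is indecomposable. *)
Lemma indecomposable_thin_rooted :
  indecomposable X -> thin X /\ rooted X depth.
Proof.
move=> indX.
have [[x0 [nx0 min_x0]]|zeroX] :
    (exists x0 : element, tagged x0 != point /\
      forall i, live X i -> depth (tag x0) <= depth i) \/
    (forall i, ~ live X i).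
- have [[i [x nx]]|noX] := pselect (exists i, live X i); last first.
    by right=> i li; apply: noX; exists i.
  have ex : exists n, `[< exists i, live X i /\ depth i = n >].
    by exists (depth i); apply/asboolP; exists i; split=> //; exists x.
  left; case: (ex_minnP ex) => n /asboolP[j [[y ny] <-]] min_n.
  exists (Elt j y); split=> // k lk; apply/min_n/asboolP.
  by exists k.
- pose D i := [set x : X i | x = point \/ descendant x0 (Elt i x)].
  pose E i := [set x : X i | x = point \/ ~ descendant x0 (Elt i x)].
  have D_rmap a : [set rmap x | x in D (source a)] `<=` D (target a).
    move=> _ [x [->|dx] <-]; first by left; case: (rmap_mor X a).
    by right; apply: descendant_rmap.
  have E_rmap a : [set rmap x | x in E (source a)] `<=` E (target a).
    have [f0 finj] := rmap_mor X a.
    move=> _ [x [->|ndx] <-]; first by left.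
    have [e|nfx] := eqVneq (rmap x) point; [by left | right].
    have nx : x != point by apply: contraNneq nfx => ->; rewrite f0.
    case/descendant_target => [ex0|[x' dx' e]].
      have := min_x0 (source a) (ex_intro _ x nx).
      by rewrite ex0 /= depth_target ltnn.
    apply: ndx; rewrite (finj x x') //; apply/mem_set => /= ef.
    - by rewrite ef eqxx in nfx.
    - by rewrite e ef eqxx in nfx.
  have desc0 : descendant x0 (Elt _ (tagged x0)).
    by case: (x0) => k z; apply: descendant_refl.
  have all_desc i (x : X i) : x != point -> descendant x0 (Elt i x).
    move=> nx; apply: contrapT => ndx; apply: indX.
    apply: (@complement_decomposable _ _
      (Subrep (fun i => or_introl (erefl (point : X i))) D_rmap)
      (Subrep (fun i => or_introl (erefl (point : X i))) E_rmap)).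
    - by move=> j y /= [//|dy] [].
    - move=> j y /=; have [dy|ndy] := pselect (descendant x0 (Elt j y)).
        by left; right.
      by right; right.
    - by exists (tag x0); exists (tagged x0) => //; right.
    - by exists i; exists x => //; right.
  split=> [i x y nx ny|a i li lt_i y ny].
    exact: descendant_unique (all_desc _ _ nx) (all_desc _ _ ny).
  case/descendant_target: (all_desc _ _ ny) => [ex0|[x _ ey]].
    by have := min_x0 i li; rewrite ex0 /= leqNgt lt_i.
  exists x => //; apply: contraNneq ny => ex.
  by rewrite ey ex; case: (rmap_mor X a) => ->.
- split=> [i x y nx|a i /zeroX//].
  by case: (zeroX i); exists x.
Qed.

End ForestQuiver.

(** * Subrepresentations of a thin representation as sets of vertices *)

Section ThinSubreps.
Variables (Q : quiver) (depth : vertex Q -> nat).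
Hypothesis depth_target : forall a : arrow Q,
  depth (target a) = (depth (source a)).+1.
Variable X : representation Q.
Hypotheses (thinX : thin X) (rootedX : rooted X depth).

Definition rep_support : {set vertex Q} := [set i | `[< live X i >]]%SET.

Definition subrep_support (U : subrep X) : {set vertex Q} :=
  [set i | `[< exists2 x, U i x & x != point >]]%SET.

Definition arrow_closed (A : {set vertex Q}) :=
  forall a : arrow Q,
    source a \in A -> target a \in rep_support -> target a \in A.

Lemma subrep_supportP (U : subrep X) (i : vertex Q) :
  reflect (exists2 x, U i x & x != point) (i \in subrep_support U).
Proof. by rewrite finset.inE; apply: asboolP. Qed.

Lemma rep_supportP (i : vertex Q) : reflect (live X i) (i \in rep_support).
Proof. by rewrite finset.inE; apply: asboolP. Qed.

Lemma subrep_support_sub (U : subrep X) : subrep_support U \subset rep_support.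
Proof.
by apply/fintype.subsetP => i /subrep_supportP[x _ nx]; apply/rep_supportP; exists x.
Qed.

Lemma subrep_support_le (U V : subrep X) :
  (U <= V)%O = (subrep_support U \subset subrep_support V).
Proof.
apply/asboolP/fintype.subsetP => [UV i /subrep_supportP[x Ux nx]|UV i x Ux].
  by apply/subrep_supportP; exists x => //; apply: UV.
have [->|nx] := eqVneq x point; first exact: subrep_point.
have /subrep_supportP[y Vy ny] : i \in subrep_support V.
  by apply/UV/subrep_supportP; exists x.
by rewrite (thinX nx ny).
Qed.

Lemma subrep_support_inj : injective subrep_support.
Proof.
by move=> U V e; apply: Order.POrderTheory.le_anti; rewrite !subrep_support_le e subxx.
Qed.

Lemma subrep_support_closed (U : subrep X) : arrow_closed (subrep_support U).
Proof.
move=> a /subrep_supportP[x Ux nx] /rep_supportP[y ny].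
have [||x' nx' ey] := rootedX (i := source a) _ _ ny.
- by exists x.
- by rewrite depth_target.
apply/subrep_supportP; exists y => //; rewrite ey (thinX nx' nx).
by apply: subrep_rmap; exists x.
Qed.

Lemma subrep_support_onto (A : {set vertex Q}) :
  A \subset rep_support -> arrow_closed A -> exists U, subrep_support U = A.
Proof.
move=> AZ clA; pose W i := [set x : X i | x = point \/ i \in A].
have W_rmap a : [set rmap x | x in W (source a)] `<=` W (target a).
  move=> _ [x [->|sA] <-]; first by left; case: (rmap_mor X a).
  have [->|nfx] := eqVneq (rmap x) point; [by left | right].
  by apply: clA sA _; apply/rep_supportP; exists (rmap x).
exists (Subrep (fun i => or_introl (erefl (point : X i))) W_rmap).
apply/setP => i; apply/subrep_supportP/idP => [[x /= [->|//]]|iA].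
  by rewrite eqxx.
by have /rep_supportP[x nx] := fintype.subsetP AZ i iA; exists x => //; right.
Qed.

Lemma subrep_dim_support (U : subrep X) : subrep_dim U = #|subrep_support U|.
Proof.
rewrite -sum1_card [RHS]big_mkcond; apply: eq_bigr => i _ /=; rewrite /pdim.
case: (subrep_supportP U i) => [[x Ux nx]|noU].
  have -> : U i = point |` [set x].
    apply/seteqP; split=> y /=.
      by have [->|ny] := eqVneq y point; [left | right; apply: thinX].
    by case=> ->; first exact: subrep_point.
  by rewrite fset_setU1 // fset_set1 cardfsU1 cardfs1 in_fset1 eq_sym nx.
have -> : U i = [set point].
  apply/seteqP; split=> y /=; last by move=> ->; apply: subrep_point.
  by move=> Uy; apply: contrapT => /eqP ny; apply: noU; exists y.
by rewrite fset_set1 cardfs1.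
Qed.

Lemma subrep_finite : finite_set [set: subrep X].
Proof.
rewrite -(preimage_setT subrep_support); apply: finite_preimage.
  by move=> U V _ _; apply: subrep_support_inj.
exact: finite_finset.
Qed.

Lemma subrep_bottom : exists U : subrep X, subrep_support U = finset.set0.
Proof.
by apply: subrep_support_onto => [|a]; rewrite ?finset.sub0set ?finset.inE.
Qed.

Lemma subrep_bounded : bounded (subrep X).
Proof.
split.
  have [U eU] := subrep_bottom.
  by exists U => V; rewrite subrep_support_le eU finset.sub0set.
have [||U eU] := @subrep_support_onto rep_support; first exact: subxx.
  by move=> a.
by exists U => V; rewrite subrep_support_le eU subrep_support_sub.
Qed.

(** A vertex of [V] outside [U] that is deepest possible can be added to [U]: its
    successors in the support are in [V], and deeper, hence in [U]. *)
Lemma subrep_add_vertex (U V : subrep X) : (U < V)%O ->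
  exists W, [/\ (U < W)%O, (W <= V)%O & subrep_dim W = (subrep_dim U).+1].
Proof.
rewrite Order.POrderTheory.lt_neqAle subrep_support_le => /andP[neUV UV].
have /set0Pn[v0 Dv0] : (subrep_support V :\: subrep_support U)%SET != finset.set0.
  rewrite finset.setD_eq0; apply: contra neUV => VU; apply/eqP/subrep_support_inj/eqP.
  by rewrite finset.eqEsubset UV.
case: (arg_maxnP depth Dv0) => v /finset.setDP[vV vU] max_v.
have [||W eW] := @subrep_support_onto (v |: subrep_support U)%SET.
- rewrite finset.subUset finset.sub1set subrep_support_sub andbT.
  exact: (fintype.subsetP (subrep_support_sub V)).
- move=> a; rewrite !in_setU1 => /predU1P[sv|sU] tZ; apply/orP; right.
    have tV : target a \in subrep_support V.
      by apply: subrep_support_closed tZ; rewrite sv.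
    apply: contraT => tU.
    have /max_v : target a \in (subrep_support V :\: subrep_support U)%SET.
      by rewrite finset.inE tU tV.
    by rewrite depth_target sv /= ltnn.
  exact: subrep_support_closed.
exists W; split.
- rewrite Order.POrderTheory.lt_neqAle subrep_support_le eW finset.subsetUr andbT.
  by apply: contraNneq vU => eUW; rewrite eUW eW setU11.
- by rewrite subrep_support_le eW finset.subUset finset.sub1set vV.
- by rewrite !subrep_dim_support eW cardsU1 vU.
Qed.

Lemma subrep_graded : graded (fun U : subrep X => subrep_dim U).
Proof.
split=> [U minU|U V [VU noW]].
  have [Z eZ] := subrep_bottom.
  suff -> : U = Z by rewrite subrep_dim_support eZ cards0.
  apply/esym/eqP; apply: contraNT (minU Z) => neZU.
  by rewrite Order.POrderTheory.lt_neqAle neZU subrep_support_le eZ finset.sub0set.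
have [W [VW WU dW]] := subrep_add_vertex VU.
move: (noW W); rewrite VW Order.POrderTheory.lt_neqAle WU andbT negbK.
by move=> /eqP <-.
Qed.

End ThinSubreps.

(** * The poset of subrepresentations over a star *)

Section StarPoset.
Local Open Scope set_scope.

Variables (r : nat) (ell : 'I_r -> nat).

Definition ray_vertex (i : 'I_r) (k : 'I_(ell i)) : vertex (star_quiver ell) :=
  Some (Tagged (fun i => 'I_(ell i)) k).

Definition star_depth (v : vertex (star_quiver ell)) : nat :=
  if v is Some p then (tagged p).+1 else 0.

Lemma star_target_inj : injective (@target (star_quiver ell)).
Proof. by move=> a b []. Qed.

Lemma star_depth_target (a : arrow (star_quiver ell)) :
  star_depth (target a) = (star_depth (source a)).+1.
Proof. by case: a => i [[|k] lt_k]. Qed.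

Lemma star_source_next (i : 'I_r) (k k' : 'I_(ell i)) : k' = k.+1 :> nat ->
  source (Tagged (fun i => 'I_(ell i)) k' : arrow (star_quiver ell)) =
    ray_vertex k.
Proof.
case: k' => [[|n] lt_n] //= [ekn].
by congr (Some (Tagged _ _)); apply: val_inj.
Qed.

Variable X : representation (star_quiver ell).
Hypotheses (thinX : thin X) (rootedX : rooted X star_depth).

Let Z := rep_support X.

Lemma star_support_source (a : arrow (star_quiver ell)) v :
  v \in Z -> target a \in Z -> star_depth v < star_depth (target a) ->
  source a \in Z.
Proof.
move=> /rep_supportP lv /rep_supportP[y ny] lt_v; apply/rep_supportP.
by have [x nx _] := rootedX lv lt_v ny; exists x.
Qed.

Definition ray_part (A : {set vertex (star_quiver ell)}) (i : 'I_r) :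
  {set 'I_(ell i)} := [set k | ray_vertex k \in A].

Lemma in_ray_part A i k : (k \in ray_part A i) = (ray_vertex k \in A).
Proof. by rewrite finset.inE. Qed.

Definition ray_profile (A : {set vertex (star_quiver ell)}) : seq nat :=
  [seq #|ray_part A i| | i <- enum 'I_r].

Lemma ray_part_subset (A B : {set vertex (star_quiver ell)}) (i : 'I_r) :
  A \subset B -> ray_part A i \subset ray_part B i.
Proof.
move=> AB; apply/fintype.subsetP => k; rewrite !in_ray_part.
exact: (fintype.subsetP AB).
Qed.

Lemma ray_profile_le (A B : {set vertex (star_quiver ell)}) :
  reflect (forall i, #|ray_part A i| <= #|ray_part B i|)
          (all2 leq (ray_profile A) (ray_profile B)).
Proof.
have all2_map (T : Type) (f g : T -> nat) s :
    all2 leq (map f s) (map g s) = all (fun i => f i <= g i) s.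
  by elim: s => //= i s ->.
rewrite all2_map; apply: (iffP allP) => [le_AB i|le_AB i _ //].
by apply: le_AB; rewrite mem_enum.
Qed.

(** The support has no gap between two of its vertices on a ray, so
    [arrow_closed A] carries a vertex of [A] to all later vertices of the
    support on that ray. *)
Lemma ray_part_upper (A : {set vertex (star_quiver ell)}) (i : 'I_r) :
  A \subset Z -> arrow_closed X A -> upper_in (ray_part Z i) (ray_part A i).
Proof.
move=> AZ clA k k'; rewrite !in_ray_part => kA.
elim: (nat_of_ord k') {-2}k' (erefl (nat_of_ord k')) => [|n IH] {}k' ek' k'Z le_kk'.
  by rewrite (_ : k' = k) //; apply: ord_inj; lia.
have [ekk'|nkk'] := eqVneq k k'; first by rewrite -ekk'.
have lt_kk' : k < k' by rewrite ltn_neqAle nkk'.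
have lt_n : n < ell i by have := ltn_ord k'; rewrite ek'; apply: ltnW.
pose a : arrow (star_quiver ell) := Tagged (fun i => 'I_(ell i)) k'.
have sa : source a = ray_vertex (Ordinal lt_n) by apply: star_source_next.
suff sA : source a \in A by apply: (clA a).
rewrite sa; apply: IH => //=; last by lia.
rewrite -sa; apply: (star_support_source (v := ray_vertex k)) => //.
exact: (fintype.subsetP AZ).
Qed.

(** Since the center has depth 0, the support has all vertices between the center
    and any of its vertices. *)
Lemma center_full (A : {set vertex (star_quiver ell)}) :
  A \subset Z -> arrow_closed X A -> None \in A -> A = Z.
Proof.
move=> AZ clA cA; apply/eqP; rewrite finset.eqEsubset AZ /=.
have cZ := fintype.subsetP AZ _ cA.
apply/fintype.subsetP => v.
elim: (star_depth v) {-2}v (erefl (star_depth v)) => [|n IH] [a|] //= ea aZ.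
apply: (clA a) => //; apply: IH.
  by apply: eq_add_S; rewrite -star_depth_target.
exact: star_support_source cZ aZ _.
Qed.

(** Upper segments of the same ray are nested according to their lengths, so away
    from the center the order is the product order of the profiles. *)
Lemma subset_ray_profile (A B : {set vertex (star_quiver ell)}) :
  A \subset Z -> arrow_closed X A -> B \subset Z -> arrow_closed X B ->
  None \notin A -> all2 leq (ray_profile A) (ray_profile B) -> A \subset B.
Proof.
move=> AZ clA BZ clB cA /ray_profile_le le_AB.
apply/fintype.subsetP => -[[i k] kA|]; last by rewrite (negbTE cA).
have AB : ray_part A i \subset ray_part B i.
  apply: (upper_in_subset (S := ray_part Z i)) (le_AB i);
    by [apply: ray_part_subset | apply: ray_part_upper].
by have := fintype.subsetP AB k; rewrite !in_ray_part; apply.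
Qed.

Lemma ray_profile_onto (y : seq nat) : all2 leq y (ray_profile Z) ->
  exists A : {set vertex (star_quiver ell)},
    [/\ A \subset Z, arrow_closed X A, ray_profile A = y & #|A| = sumn y].
Proof.
move=> yZ; have sy : size y = r.
  by move: yZ; rewrite all2E => /andP[/eqP -> _]; rewrite size_map size_enum_ord.
have le_y (i : 'I_r) : nth 0 y i <= #|ray_part Z i|.
  move: yZ; rewrite all2E => /andP[/eqP sz /(all_nthP (0, 0)) /(_ i)].
  rewrite size_zip nth_zip // -sz minnn sy ltn_ord => /(_ isT) /=.
  by rewrite (nth_map i) ?size_enum_ord // nth_ord_enum.
pose B i := sval (cid (upper_in_card (le_y i))).
have HB i : [/\ B i \subset ray_part Z i, upper_in (ray_part Z i) (B i)
    & #|B i| = nth 0 y i] by rewrite /B; case: cid.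
pose T := [set p : {i : 'I_r & 'I_(ell i)} | tagged p \in B (tag p)].
pose A : {set vertex (star_quiver ell)} := [set Some p | p in T].
have memA i (k : 'I_(ell i)) : (ray_vertex k \in A) = (k \in B i).
  by rewrite /A /ray_vertex finset.mem_imset ?finset.inE //; apply: Some_inj.
have partA i : ray_part A i = B i by apply/setP => k; rewrite in_ray_part memA.
have profA : ray_profile A = y.
  apply: (@eq_from_nth _ 0); first by rewrite size_map size_enum_ord.
  move=> n; rewrite size_map size_enum_ord => lt_n.
  have -> : n = Ordinal lt_n by [].
  rewrite (nth_map (Ordinal lt_n)) ?size_enum_ord // nth_ord_enum partA.
  by have [_ _ ->] := HB (Ordinal lt_n).
exists A; split=> //.
- apply/fintype.subsetP => _ /imsetP[[i k] kB ->].
  have [/fintype.subsetP BZ _ _] := HB i.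
  by move: kB; rewrite finset.inE /= => /BZ; rewrite in_ray_part.
- move=> [i k] sA tZ; have [_ upB _] := HB i.
  rewrite (memA i k).
  case: k sA tZ => [[|n] lt_n] /= sA tZ; first by case/imsetP: sA.
  apply: (upB (Ordinal (ltnW lt_n))) => //.
    by rewrite -memA.
  by rewrite in_ray_part.
- rewrite card_imset; last exact: Some_inj.
  rewrite -profA sumnE big_map big_enum /=.
  under [RHS]eq_bigr => i _ do rewrite partA -sum1_card.
  rewrite sig_big_dep -sum1_card; apply: eq_bigl => p.
  by rewrite finset.inE.
Qed.

(** The profile forgets whether the center is present. The label is taken of the
    profile alone all the same: the only subrepresentation that contains the
    center is the top, which may join any chain. *)
Lemma star_sperner : sperner (fun U : subrep X => subrep_dim U).
Proof.
split; [exact: subrep_finite | exact: subrep_bounded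
      | exact: subrep_graded star_depth_target _ _ _ |].
pose m := ray_profile Z.
pose lab (U : subrep X) := chain_label m (ray_profile (subrep_support U)).
have prof_le (U : subrep X) : all2 leq (ray_profile (subrep_support U)) m.
  apply/ray_profile_le => i; apply/subset_leq_card/ray_part_subset.
  exact: subrep_support_sub.
have clU := subrep_support_closed star_depth_target thinX rootedX.
have lab_comparable (U V : subrep X) : lab U = lab V -> (U >=< V)%O.
  wlog le_sum : U V / sumn (ray_profile (subrep_support U)) <=
      sumn (ray_profile (subrep_support V)).
    move=> hwlog eUV.
    have [le|/ltnW le] := leqP (sumn (ray_profile (subrep_support U)))
      (sumn (ray_profile (subrep_support V))); first exact: hwlog.
    by rewrite Order.POrderTheory.comparable_sym; apply: hwlog.
  move=> eUV; have [cU|cU] := boolP (None \in subrep_support U).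
    apply: Order.POrderTheory.ge_comparable; rewrite subrep_support_le //.
    by rewrite (center_full (subrep_support_sub U) (clU U) cU) subrep_support_sub.
  apply: Order.POrderTheory.le_comparable; rewrite subrep_support_le //.
  apply: subset_ray_profile => //; try exact: subrep_support_sub.
  exact: chain_label_comparable (prof_le U) (prof_le V) eUV le_sum.
pose p := (sumn m)./2.
have proj (U : subrep X) : exists W : subrep X, lab W = lab U /\ subrep_dim W = p.
  have [b1 b2] := chain_label_bounds (prof_le U).
  have [|y [ym ey sy]] := @chain_label_onto m _ p (prof_le U).
    by rewrite /p; lia.
  have [A [AZ clA profA cardA]] := ray_profile_onto ym.
  have [W eW] := subrep_support_onto AZ clA.
  exists W; split; first by rewrite /lab eW profA.
  by rewrite subrep_dim_support // eW cardA.
have [kappa Hkappa] := boolp.choice proj.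
exists p => F antiF.
have kappa_inj : {in F &, injective kappa}.
  move=> U V /set_mem FU /set_mem FV eUV; apply: contrapT => neUV.
  have := antiF U V FU FV neUV; rewrite lab_comparable //.
  by rewrite -(Hkappa U).1 eUV (Hkappa V).1.
rewrite -(card_le_eql (inj_card_eq kappa_inj)); apply: subset_card_le.
by move=> _ [U _ <-]; case: (Hkappa U).
Qed.

End StarPoset.

Theorem proposition3p5 (r : nat) (hr : (1 <= r)%N)
    (ell : 'I_r -> nat) (hell : forall i : 'I_r, (1 <= ell i)%N)
    (X : representation (star_quiver ell)) (hX : indecomposable X) :
  sperner (fun U : subrep X => subrep_dim U).
Proof.
have [thinX rootedX] := indecomposable_thin_rooted (@star_target_inj r ell)
  (@star_depth_target r ell) hX.
exact: star_sperner.
Qed.
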